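(* Let $\mathcal{H}$ be a hypergraph and let $\phi$ be a weight on $\mathcal{H}$. For each $n\geq 0$, $$H_n(\mathcal{H},\phi;\mathbb{F})\cong\mathrm{Ker}(L_n^{\mathrm{Inf}^\phi_*(\mathcal{H}),\phi})\cong\mathrm{Ker}(L_n^{\mathrm{Sup}^\phi_*(\mathcal{H}),\phi}).$$ In other words, $$H_n(\mathcal{H},\phi;\mathbb{F})\cong\mathrm{Ker}(\partial^\phi_n|_{\mathrm{Inf}^\phi_*(\mathcal{H})})\cap\mathrm{Ker}(\partial^\phi_{n+1}|_{\mathrm{Inf}^\phi_*(\mathcal{H})})^*\cong\mathrm{Ker}(\partial^\phi_n|_{\mathrm{Sup}^\phi_*(\mathcal{H})})\cap\mathrm{Ker}(\partial^\phi_{n+1}|_{\mathrm{Sup}^\phi_*(\mathcal{H})})^*.$$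
   Context: $\mathbb{F}$ is $\mathbb{R}$ or $\mathbb{C}$. A hypergraph $\mathcal{H}$ is a collection of nonempty finite subsets (hyperedges) of a vertex set, each vertex lying in at least one hyperedge; hypergraphs have finitely many hyperedges. An $n$-hyperedge has $n+1$ vertices. The associated simplicial complex $\Delta\mathcal{H}$ consists of all nonempty subsets of hyperedges of $\mathcal{H}$. Fix a total order on the vertices; for an $n$-simplex $\sigma=\{v_0<\dots<v_n\}$ and $0\le i\le n$, $d_i\sigma=\sigma\setminus\{v_i\}$. $\mathbb{F}(\Delta\mathcal{H})_n$ is the vector space with basis the $n$-simplices of $\Delta\mathcal{H}$ (zero if $n<0$), with the inner product making the simplices orthonormal; $\mathbb{F}(\Delta\mathcal{H})=\bigoplus_n\mathbb{F}(\Delta\mathcal{H})_n$; $\mathbb{F}(\mathcal{H})_n\subseteq\mathbb{F}(\Delta\mathcal{H})_n$ is the span of the $n$-hyperedges. A weight on $\mathcal{H}$ is a bilinear map $\phi:\mathbb{F}(\Delta\mathcal{H})\times\mathbb{F}(\Delta\mathcal{H})\to\mathbb{F}$ with $\phi(d_i\sigma,d_jd_i\sigma)\phi(\sigma,d_i\sigma)=\phi(d_j\sigma,d_jd_i\sigma)\phi(\sigma,d_j\sigma)$ for all simplices $\sigma\in\Delta\mathcal{H}$ and all $j<i$. The weighted boundary map is $\partial^\phi_n\sigma=\sum_{i=0}^n(-1)^i\phi(\sigma,d_i\sigma)d_i\sigma$ (with $\partial^\phi_0=0$); it satisfies $\partial^\phi_{n-1}\partial^\phi_n=0$. $\mathrm{Inf}^\phi_n(\mathcal{H})=\mathbb{F}(\mathcal{H})_n\cap(\partial^\phi_n)^{-1}\mathbb{F}(\mathcal{H})_{n-1}$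 and $\mathrm{Sup}^\phi_n(\mathcal{H})=\mathbb{F}(\mathcal{H})_n+\partial^\phi_{n+1}\mathbb{F}(\mathcal{H})_{n+1}$ form chain complexes under the restrictions of $\partial^\phi_*$, with inner products inherited from $\mathbb{F}(\Delta\mathcal{H})_n$. The weighted embedded homology is $H_n(\mathcal{H},\phi;\mathbb{F})=H_n(\mathrm{Inf}^\phi_*(\mathcal{H}))\cong H_n(\mathrm{Sup}^\phi_*(\mathcal{H}))$ (isomorphism induced by inclusion). For $C_*$ equal to $\mathrm{Inf}^\phi_*(\mathcal{H})$ or $\mathrm{Sup}^\phi_*(\mathcal{H})$, $\partial^\phi_n|_{C_*}$ denotes the restricted map $C_n\to C_{n-1}$, $(\partial^\phi_n|_{C_*})^*:C_{n-1}\to C_n$ its adjoint, and $L_n^{C_*,\phi}=(\partial^\phi_{n+1}|_{C_*})(\partial^\phi_{n+1}|_{C_*})^*+(\partial^\phi_n|_{C_*})^*(\partial^\phi_n|_{C_*})$ on $C_n$. *)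

(* Defs.v *)
From HB Require Import structures.
From mathcomp Require Import all_boot all_order all_algebra.
From mathcomp Require Import zify complex reals.
From mathcomp Require classical_sets.

Set Implicit Arguments.
Unset Strict Implicit.
Unset Printing Implicit Defensive.

Import Order.TTheory GRing.Theory Num.Theory.
Local Open Scope quotient_scope.
Local Open Scope ring_scope.

(* [conj] is the conjugation used in inner products over [F]. *)
Variant real_or_complex (R : realType) :
    forall F : numFieldType, {rmorphism F -> F} -> Prop :=
  | RealScalars : @real_or_complex R R idfun
  | ComplexScalars : @real_or_complex R R[i] (@conjc R).

Definition isomorphic (F : nzRingType) (U V : lmodType F) : Prop :=
  exists f : {linear U -> V}, bijective f.

Section QuotientSpace.
Variables (F : fieldType) (vT : vectType F) (W : {vspace vT}).

Definition quotv : Type := Quotient.quot (pred_of_vspace W).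
HB.instance Definition _ := GRing.Zmodule.on quotv.
HB.instance Definition _ := Quotient.on quotv.
HB.instance Definition _ := EqQuotient.on quotv.
HB.instance Definition _ := ZmodQuotient.on quotv.

Definition scaleq (a : F) (x : quotv) : quotv :=
  \pi_quotv (a *: repr x).

Lemma pi_scaleq a (x : vT) :
  scaleq a (\pi_quotv x) =
  \pi_quotv (a *: x).
Proof.
apply/eqP; rewrite -Quotient.idealrBE -scalerBr rpredZ//.
by rewrite Quotient.idealrBE reprK.
Qed.

Lemma pi_addq (x y : vT) : \pi_quotv (x + y) = \pi_quotv x + \pi_quotv y.
Proof. exact: pi_addr. Qed.

Lemma scaleqA a b x : scaleq a (scaleq b x) = scaleq (a * b) x.
Proof.
by elim/quotW: x => x; rewrite (pi_scaleq b) (pi_scaleq a) pi_scaleq scalerA.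
Qed.

Lemma scale1q : left_id 1 scaleq.
Proof. by elim/quotW => x; rewrite pi_scaleq scale1r. Qed.

Lemma scaleqDr : right_distributive scaleq +%R.
Proof.
move=> a; elim/quotW => x; elim/quotW => y.
by rewrite -pi_addq !pi_scaleq scalerDr pi_addq.
Qed.

Lemma scaleqDl x : {morph scaleq^~ x : a b / a + b}.
Proof.
elim/quotW: x => x a b.
by rewrite !pi_scaleq scalerDl pi_addq.
Qed.

HB.instance Definition _ :=
  GRing.Zmodule_isLmodule.Build F quotv scaleqA scale1q scaleqDr scaleqDl.

End QuotientSpace.

(* Ker g / Im f.  The image is taken inside Ker g, which it is part of as soon
   as g \o f = 0. *)
Definition homology (F : fieldType) (U V W : vectType F)
    (f : 'Hom(U, V)) (g : 'Hom(V, W)) : lmodType F :=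
  quotv (linfun (vsval : subvs_of (lker g) -> V) @^-1: limg f)%VS.

(* [vsproj W] is the identity on [W], so this is the restriction of [f] to a map
   from U to W when f maps U into W, see [restrictE].  It is only used on
   boundary maps, where [boundary_Inf] and [boundary_Sup] apply. *)
Definition restrict (F : fieldType) (vT : vectType F) (f : 'End(vT))
    (U W : {vspace vT}) : 'Hom(subvs_of U, subvs_of W) :=
  linfun (vsproj W \o f \o vsval).

Lemma restrictE (F : fieldType) (vT : vectType F) (f : 'End(vT))
    (U W : {vspace vT}) (u : subvs_of U) :
  f (vsval u) \in W -> vsval (restrict f U W u) = f (vsval u).
Proof. by move=> fuW; rewrite lfunE/= vsprojK. Qed.

Record hypergraph (V : finType) := Hypergraph {
  hyperedges :> {set {set V}};
  hyperedges_neq0 : set0 \notin hyperedges;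
  hyperedges_cover : cover hyperedges = [set: V]
}.

Section Hypergraph.
Variables (d : Order.disp_t) (V : finOrderType d) (H : hypergraph V).

Definition Delta : {set {set V}} :=
  [set s : {set V} | (s != set0) && [exists e in H, s \subset e]].

Definition simplex := {s : {set V} | s \in Delta}.

(* [Order.enum s] lists [s] increasingly, so this is s minus v_i when
   i < #|s|. *)
Definition face (s : {set V}) (i : nat) : {set V} :=
  [set v in s | index v (Order.enum s) != i].

Variable F : fieldType.

Definition chain : vectType F := {ffun simplex -> F^o}.

(* The basis vector of [s] if [s] is a simplex.  It is 0 otherwise: the empty
   face of a vertex is 0 as a chain. *)
Definition simp (s : {set V}) : chain := [ffun t => (val t == s)%:R].

(* Degrees are integers, an n-simplex having n + 1 vertices, so the spaces
   below are 0 for n < 0. *)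
Definition hyperedge_chains (n : int) : {vspace chain} :=
  <<[seq simp s | s <- enum [set s in hyperedges H | (#|s|%:Z == n + 1)%R]]>>%VS.

Definition is_weight (phi : {biscalar chain}) : Prop :=
  forall (s : {set V}) (i j : nat), s \in Delta -> (j < i < #|s|)%N ->
    phi (simp (face s i)) (simp (face (face s i) j)) *
      phi (simp s) (simp (face s i)) =
    phi (simp (face s j)) (simp (face (face s i) j)) *
      phi (simp s) (simp (face s j)).

Variable phi : {biscalar chain}.

Definition boundary_simp (s : {set V}) : chain :=
  \sum_(i < #|s|) ((-1) ^+ i * phi (simp s) (simp (face s i))) *:
    simp (face s i).

Definition boundary_fun (n : int) (c : chain) : chain :=
  \sum_(s : simplex | #|val s|%:Z == n + 1) c s *: boundary_simp (val s).

Lemma boundary_fun_is_linear n : linear (boundary_fun n).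
Proof.
move=> a x y; rewrite /boundary_fun scaler_sumr -big_split/=.
by apply: eq_bigr => s _; rewrite !ffunE scalerDl scalerA.
Qed.
HB.instance Definition _ n :=
  GRing.isLinear.Build F chain chain _ (boundary_fun n)
    (boundary_fun_is_linear n).

(* The weighted boundary map of degree n, extended by 0 to the simplices of
   dimension other than n. *)
Definition boundary (n : int) : 'End(chain) := linfun (boundary_fun n).

Lemma boundary_simpE (n : int) (s : {set V}) :
  s \in Delta -> #|s|%:Z = n + 1 -> boundary n (simp s) = boundary_simp s.
Proof.
move=> sD sn; rewrite lfunE/= /boundary_fun (bigD1 (exist _ s sD))/= ?sn//.
rewrite ffunE/= eqxx scale1r big1 ?addr0// => t /andP[_ ts].
by rewrite ffunE -(inj_eq val_inj)/= in ts *; rewrite (negPf ts) scale0r.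
Qed.

Definition Inf (n : int) : {vspace chain} :=
  (hyperedge_chains n :&: boundary n @^-1: hyperedge_chains (n - 1)%R)%VS.

Definition Sup (n : int) : {vspace chain} :=
  (hyperedge_chains n + boundary (n + 1)%R @: hyperedge_chains (n + 1)%R)%VS.

Definition sub_boundary (C : int -> {vspace chain}) (n : int) :
    'Hom(subvs_of (C n), subvs_of (C (n - 1))) :=
  restrict (boundary n) (C n) (C (n - 1)).

(* This is [sub_boundary C (n + 1)], but with codomain [C n] instead of
   [C (n + 1 - 1)], which is not convertible to it. *)
Definition sub_boundaryS (C : int -> {vspace chain}) (n : int) :
    'Hom(subvs_of (C (n + 1)), subvs_of (C n)) :=
  restrict (boundary (n + 1)) (C (n + 1)) (C n).

Definition embedded_homology (n : int) : lmodType F :=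
  homology (sub_boundaryS Inf n) (sub_boundary Inf n).

End Hypergraph.

Section BoundaryFacts.
Variables (d : Order.disp_t) (V : finOrderType d) (H : hypergraph V).
Implicit Type s : {set V}.

Lemma enum_face s i :
  Order.enum (face s i) = [seq v <- Order.enum s | index v (Order.enum s) != i].
Proof.
apply: (sorted_eq (leT := <=%O)) => //; [exact: le_trans|exact: le_anti|..].
- exact/sort_sorted/le_total.
- exact/(sorted_filter le_trans)/sort_sorted/le_total.
- apply: uniq_perm; rewrite ?filter_uniq ?sort_uniq ?enum_uniq// => v.
  by rewrite mem_filter !mem_sort !mem_enum inE andbC.
Qed.

Lemma index_face s i v : v \in face s i ->
  index v (Order.enum (face s i)) =
  unbump i (index v (Order.enum s)).
Proof.
rewrite inE => /andP[vs]; rewrite enum_face.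
have : v \in Order.enum s by rewrite mem_sort mem_enum.
have : uniq (Order.enum s) by rewrite sort_uniq enum_uniq.
move: (Order.enum s) => l ul vl vi.
elim: l i ul vl vi => // x l IH i /= /andP[xl ul].
rewrite inE eqxx; case: eqVneq => [->|vx] /=.
  by move=> _ i0; rewrite i0/= eqxx /unbump; case: i i0.
move=> vl vi.
have -> : [seq w <- l | (if x == w then 0 else (index w l).+1)%N != i] =
    [seq w <- l | (index w l).+1 != i].
  apply: eq_in_filter => w wl; rewrite ifN//.
  by apply: contraNneq xl => ->.
case: i vi => [|i] vi /=.
  rewrite (eq_filter (a2 := predT))// filter_predT /unbump; lia.
rewrite ifN; last by rewrite eq_sym.
have -> : [seq w <- l | (index w l).+1 != i.+1] = [seq w <- l | index w l != i].
  by apply: eq_filter.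
rewrite IH// /unbump; lia.
Qed.

Lemma face_face s i j : (j < i)%N ->
  face (face s i) j = face (face s j) i.-1.
Proof.
move=> ji; apply/setP => v.
rewrite {1}/face [in RHS]/face [LHS]inE [RHS]inE.
have [vi|vi] := boolP (v \in face s i); have [vj|vj] := boolP (v \in face s j) => /=.
- rewrite !index_face//; move: vi vj; rewrite !inE /unbump.
  move=> /andP[_ a] /andP[_ b]; lia.
- rewrite index_face//; move: vi vj; rewrite !inE /unbump => /andP[-> a] /=.
  by rewrite negbK => /eqP b; lia.
- rewrite index_face//; move: vi vj; rewrite !inE /unbump => a /andP[b c].
  by move: a; rewrite b /= negbK => /eqP a; lia.
- by [].
Qed.

Lemma card_face s i : (i < #|s|)%N -> #|face s i| = #|s|.-1.
Proof.
move=> ilt.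
have Es : size (Order.enum s) = #|s| by rewrite size_sort -cardE.
have [x xs] : exists x, x \in s by apply/card_gt0P; lia.
have U : uniq (Order.enum s) by rewrite sort_uniq enum_uniq.
suff -> : face s i = s :\ nth x (Order.enum s) i.
  rewrite [X in _ = X.-1](cardsD1 (nth x (Order.enum s) i)).
  by rewrite -[_ \in s]mem_enum -(mem_sort <=%O) mem_nth// Es.
apply/setP => v; rewrite !inE andbC; case vs : (v \in s); rewrite ?andbF// !andbT.
have vl : v \in Order.enum s by rewrite mem_sort mem_enum.
by rewrite -{2}(nth_index x vl) nth_uniq ?Es// -Es index_mem.
Qed.

Lemma face_Delta s i : s \in Delta H -> (1 < #|s|)%N -> (i < #|s|)%N ->
  face s i \in Delta H.
Proof.
rewrite !inE => /andP[_ /existsP[e /andP[eH se]]] s1 si; apply/andP; split.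
  by rewrite -card_gt0 card_face//; lia.
apply/existsP; exists e; rewrite eH (subset_trans _ se)//.
by apply/subsetP => v; rewrite inE => /andP[].
Qed.

Variables (F : fieldType) (phi : {biscalar chain H F}).
Hypothesis hphi : is_weight phi.

Lemma simp0 s : s \notin Delta H -> simp H F s = 0.
Proof.
move=> sD; apply/ffunP => t; rewrite !ffunE; case: eqP => // ts.
by rewrite -ts (valP t) in sD.
Qed.

Lemma boundary_simp1 s : (#|s| <= 1)%N -> boundary_simp phi s = 0.
Proof.
move=> s1; rewrite /boundary_simp big1// => i _; rewrite (@simp0 (face s i)) ?scaler0//.
rewrite inE negb_and negbK -cards_eq0 card_face//; apply/orP; left; lia.
Qed.

Lemma boundary_boundary_simp s (n : int) : s \in Delta H -> #|s|%:Z = n + 1 ->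
  boundary phi (n - 1) (boundary_simp phi s) = 0.
Proof.
move=> sD sn.
have [s1|s1] := leqP #|s| 1; first by rewrite boundary_simp1// linear0.
rewrite /boundary_simp linear_sum/=.
pose T (i j : nat) := ((-1) ^+ i * phi (simp H F s) (simp H F (face s i))) *:
  (((-1) ^+ j * phi (simp H F (face s i)) (simp H F (face (face s i) j))) *:
     simp H F (face (face s i) j)).
rewrite (eq_bigr (fun i : 'I_#|s| => \sum_(j < #|s|.-1) T i j)); last first.
  move=> i _; rewrite linearZ/= boundary_simpE ?face_Delta ?card_face//; last lia.
  by rewrite /boundary_simp card_face// scaler_sumr.
have [m em] : exists m, #|s| = m.+1 by exists #|s|.-1; lia.
rewrite em /=.
have TE i j : (j <= i < m)%N -> T i.+1 j = - T j i.
  move=> /andP[ji im].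
  have := @hphi s i.+1 j sD; rewrite em !ltnS ji im => /(_ isT) E.
  rewrite /T (@face_face s i.+1 j)//= in E *.
  rewrite !scalerA -scaleNr; congr (_ *: _).
  rewrite exprS mulN1r !mulNr; congr (- _).
  rewrite mulrACA [RHS]mulrACA [(-1) ^+ i * _]mulrC; congr (_ * _).
  by rewrite mulrC E mulrC.
rewrite (eq_bigr (fun i : 'I_m.+1 => \sum_(j < m | (j < i)%N) T i j +
   \sum_(j < m | ~~ (j < i)%N) T i j)); last first.
  by move=> i _; rewrite (bigID (fun j : 'I_m => (j < i)%N))/=.
rewrite big_split/= [X in X + _]big_ord_recl/= [X in X + _ + _]big_pred0//.
rewrite add0r [X in _ + X](exchange_big_dep predT)//= -big_split/= big1// => i _.
rewrite [X in _ + X]big_mkcond [X in _ + X]big_ord_recr/=.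
rewrite ltn_ord addr0 -big_mkcond/=.
rewrite (eq_bigl (fun j : 'I_m => (j <= i)%N)); last by move=> j; rewrite ltnS.
rewrite [X in _ + X](eq_bigl (fun j : 'I_m => (j <= i)%N)); last by move=> j; rewrite -leqNgt.
rewrite -big_split/= big1// => j ji.
by rewrite /bump leq0n add1n TE ?ji ?ltn_ord// addNr.
Qed.

Lemma boundary_boundary n c : boundary phi (n - 1) (boundary phi n c) = 0.
Proof.
rewrite [boundary phi n c]lfunE/= /boundary_fun linear_sum big1// => s /eqP sn.
by rewrite linearZ /= boundary_boundary_simp ?scaler0// (valP s).
Qed.

Lemma boundary_Inf n c : c \in Inf phi n -> boundary phi n c \in Inf phi (n - 1).
Proof.
rewrite memv_cap => /andP[_]; rewrite -memv_preim => cn.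
by rewrite memv_cap cn -memv_preim boundary_boundary mem0v.
Qed.

Lemma boundary_Sup n c : c \in Sup phi n -> boundary phi n c \in Sup phi (n - 1).
Proof.
move=> /memv_addP[x xn [y /memv_imgP[z zn ->] ->]].
rewrite linearD/= -{2}[n](addrK 1) boundary_boundary addr0.
by apply: (subvP (addvSr _ _)); rewrite subrK memv_img.
Qed.
End BoundaryFacts.


Section Adjoint.
Variables (d : Order.disp_t) (V : finOrderType d) (H : hypergraph V).
Variables (F : numFieldType) (conj : {rmorphism F -> F}).

Definition inner (x y : chain H F) : F := \sum_s x s * conj (y s).

Definition is_adjoint (U W : {vspace chain H F})
    (f : 'Hom(subvs_of U, subvs_of W)) (g : 'Hom(subvs_of W, subvs_of U)) :=
  forall u w, inner (vsval (f u)) (vsval w) = inner (vsval u) (vsval (g w)).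

(* Lemma [adjointP] shows that this map satisfies [is_adjoint f] when the
   scalars are real or complex. *)
Definition adjoint (U W : {vspace chain H F})
    (f : 'Hom(subvs_of U, subvs_of W)) : 'Hom(subvs_of W, subvs_of U) :=
  classical_sets.xget 0 (is_adjoint f).

Definition laplacian (phi : {biscalar chain H F})
    (C : int -> {vspace chain H F}) (n : int) : 'End(subvs_of (C n)) :=
  (sub_boundaryS phi C n \o adjoint (sub_boundaryS phi C n))%VF +
  (adjoint (sub_boundary phi C n) \o sub_boundary phi C n)%VF.

Lemma innerDl x y z : inner (x + y) z = inner x z + inner y z.
Proof.
by rewrite -big_split; apply: eq_bigr => s _; rewrite !ffunE mulrDl.
Qed.

Lemma innerZl a x z : inner (a *: x) z = a * inner x z.
Proof.
by rewrite mulr_sumr; apply: eq_bigr => s _; rewrite !ffunE mulrA.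
Qed.

Lemma innerDr x y z : inner x (y + z) = inner x y + inner x z.
Proof.
by rewrite -big_split; apply: eq_bigr => s _; rewrite !ffunE rmorphD mulrDr.
Qed.

Lemma innerZr a x z : inner x (a *: z) = conj a * inner x z.
Proof.
rewrite mulr_sumr; apply: eq_bigr => s _.
by rewrite !ffunE rmorphM mulrCA.
Qed.

Lemma inner_suml (I : finType) (a : I -> F) (x : I -> chain H F) y :
  inner (\sum_i a i *: x i) y = \sum_i a i * inner (x i) y.
Proof.
pose g z := inner z y.
rewrite -[LHS]/(g _) (big_morph g (id1 := 0) (op1 := +%R)).
- by apply: eq_bigr => i _; rewrite /g innerZl.
- by move=> z t; rewrite /g innerDl.
- by rewrite /g /inner big1// => s _; rewrite ffunE mul0r.
Qed.

Lemma inner_sumr (I : finType) (a : I -> F) (y : I -> chain H F) x :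
  inner x (\sum_i a i *: y i) = \sum_i conj (a i) * inner x (y i).
Proof.
rewrite (big_morph (inner x) (id1 := 0) (op1 := +%R)).
- by apply: eq_bigr => i _; rewrite innerZr.
- by move=> z t; rewrite innerDr.
- by rewrite /inner big1// => s _; rewrite ffunE rmorph0 mulr0.
Qed.

Variables (R : realType) (rcF : real_or_complex R conj).

Lemma real_or_complex_conjK : involutive conj.
Proof. by case: rcF => // x; exact: conjcK. Qed.

Lemma real_or_complex_mul_conj_ge0 x : 0 <= x * conj x.
Proof.
case: rcF x => [x|x]; first by rewrite -expr2 sqr_ge0.
case: x => a b /=; rewrite lecE/= !mulrN opprK mulrC addNr eqxx -!expr2.
by rewrite addr_ge0 ?sqr_ge0.
Qed.

Lemma inner_eq0 x : inner x x = 0 -> x = 0.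
Proof.
move=> /eqP; rewrite psumr_eq0 => [/allP x0|s _]; last first.
  exact: real_or_complex_mul_conj_ge0.
apply/ffunP => s; rewrite ffunE; apply/eqP.
have := x0 s; rewrite mem_index_enum => /(_ isT).
by rewrite mulf_eq0 fmorph_eq0 orbb.
Qed.

Lemma vsval_sumZ (I : finType) (U : {vspace chain H F}) (a : I -> F)
    (u : I -> subvs_of U) :
  vsval (\sum_i a i *: u i) = \sum_i a i *: vsval (u i).
Proof. by rewrite linear_sum; apply: eq_bigr => i _; rewrite linearZ. Qed.

Lemma adjointP (U W : {vspace chain H F}) (f : 'Hom(subvs_of U, subvs_of W)) :
  is_adjoint f (adjoint f).
Proof.
suff [g gP] : exists g, is_adjoint f g by exact: classical_sets.xgetI gP.
pose e := vbasis {: subvs_of U}.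
have uE u : u = \sum_i coord e i u *: e`_i by exact/coord_vbasis/memvf.
pose G : 'M[F]_(\dim {: subvs_of U}) :=
  \matrix_(i, j) inner (vsval e`_i) (vsval e`_j).
have Gunit : G \in unitmx.
  rewrite -row_free_unit -kermx_eq0; apply/eqP/row_matrixP => k.
  rewrite row0; set x := row k _.
  have xG : x *m G = 0 by rewrite -row_mul mulmx_ker row0.
  pose w := \sum_i x 0 i *: e`_i.
  have we (j : 'I_(\dim {: subvs_of U})) :
      inner (vsval w) (vsval e`_j) = 0.
    transitivity ((x *m G) 0 j); last by rewrite xG mxE.
    by rewrite vsval_sumZ inner_suml mxE; apply: eq_bigr => i _; rewrite [G _ _]mxE.
  have w0 : w = 0.
    apply/val_inj; apply: inner_eq0.
    transitivity (inner (vsval w) (\sum_i x 0 i *: vsval e`_i)).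
      by rewrite -vsval_sumZ.
    by rewrite inner_sumr big1// => i _; rewrite we mulr0.
  apply/rowP => i; rewrite [RHS]mxE.
  have /freeP : free e by exact/basis_free/vbasisP.
  by move=> /(_ (x 0)); apply.
pose b (w : subvs_of W) : 'cV[F]_(\dim {: subvs_of U}) :=
  \col_i inner (vsval (f e`_i)) (vsval w).
pose g (w : subvs_of W) : subvs_of U := \sum_j conj ((invmx G *m b w) j 0) *: e`_j.
have g_lin : linear g.
  move=> a x y; rewrite /g scaler_sumr -big_split; apply: eq_bigr => j _ /=.
  rewrite scalerA -scalerDl; congr (_ *: _).
  have -> : b (a *: x + y) = conj a *: b x + b y.
    by apply/colP => i; rewrite !mxE linearP/= innerDr innerZr.
  rewrite mulmxDr -scalemxAr mxE [X in conj (X + _)]mxE rmorphD rmorphM.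
  by rewrite real_or_complex_conjK.
pose gL := GRing.isLinear.Build F (subvs_of W) (subvs_of U) _ g g_lin.
pose g' : {linear subvs_of W -> subvs_of U} := HB.pack g gL.
exists (linfun g') => u w; rewrite lfunE/= [in LHS](uE u) [in RHS](uE u).
rewrite linear_sum; under eq_bigr do rewrite linearZ.
rewrite !vsval_sumZ !inner_suml; apply: eq_bigr => i _; congr (_ * _).
rewrite inner_sumr; transitivity ((G *m (invmx G *m b w)) i 0).
  by rewrite mulKVmx// [b w i 0]mxE.
rewrite mxE; apply: eq_bigr => j _.
by rewrite real_or_complex_conjK [G i j]mxE mulrC.
Qed.

End Adjoint.

(* Main.v *)
From HB Require Import structures.
Require Import Defs.
From mathcomp Require Import all_boot all_order all_algebra.
From mathcomp Require Import complex reals.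

Set Implicit Arguments.
Unset Strict Implicit.
Unset Printing Implicit Defensive.

(** This is Hodge theory for finite-dimensional complexes of inner product
spaces, together with a dimension count comparing the complexes Inf and Sup.

Let f : A -> B and g : B -> C be linear with g f = 0.  Positivity of the inner
product shows that (im f) and (Ker f^* ) meet trivially, and comparing ranks
shows that they span B.  Since im f is contained in Ker g, the modular law
turns this into Ker g = (Ker g :&: Ker f^* ) + im f, a direct sum
([hodge_decomposition]).  So every class in Ker g / im f has exactly one
harmonic representative ([homology_harmonic]).  The harmonic space
Ker g :&: Ker f^* is the kernel of f f^* + g^* g, because pairing that operator
with b gives |f^* b|^2 + |g b|^2 ([lker_laplacian]).  This settles the
isomorphisms between homology and harmonic spaces.

For Inf against Sup, write D_n for the span of the n-hyperedges, Z_n for the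
kernel of the boundary map and B_n for the boundaries of D_(n+1).  The cycles
of Inf are D_n :&: Z_n and its boundaries are D_n :&: B_n; those of Sup are
(D_n :&: Z_n) + B_n and B_n.  As B_n lies in Z_n, the intersection of
D_n :&: Z_n with B_n is D_n :&: B_n, so both homologies have dimension
dim (D_n :&: Z_n) - dim (D_n :&: B_n) ([dim_homology_Inf_Sup]).  The two
harmonic spaces then have equal dimensions, hence are isomorphic. *)

Import GRing.Theory Num.Theory.
Local Open Scope quotient_scope.
Local Open Scope ring_scope.

Import VectorInternalTheory.

(** * Isomorphisms of vector spaces *)

Section Isomorphisms.
Variable F : fieldType.

Lemma isomorphic_sym (U V : lmodType F) : isomorphic U V -> isomorphic V U.
Proof.
case=> f [f' fK f'K].
pose f'L := GRing.isLinear.Build F V U _ f' (GRing.can2_linear fK f'K).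
by exists (HB.pack f' f'L : {linear V -> U}); exists f.
Qed.

Lemma isomorphic_dim (U V : vectType F) : dim U = dim V -> isomorphic U V.
Proof.
move=> eUV.
have [c [c' cK c'K]] : isomorphic 'rV[F]_(dim U) 'rV[F]_(dim V).
  by rewrite eUV; exists idfun; exists idfun.
exists (r2v \o c \o v2r : {linear U -> V}).
exists (r2v \o c' \o v2r) => x /=; first by rewrite r2vK cK v2rK.
by rewrite r2vK c'K v2rK.
Qed.

(** [h] induces a map from [U] to the quotient by [W]; the two hypotheses are the
injectivity and the surjectivity of that map. *)
Lemma isomorphic_quotv (vT : vectType F) (W : {vspace vT}) (U : lmodType F)
    (h : {linear U -> vT}) :
    (forall u, h u \in W -> u = 0) -> (forall v, exists u, v - h u \in W) ->
  isomorphic (quotv W) U.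
Proof.
move=> h_inj h_surj; apply: isomorphic_sym.
pose p u : quotv W := \pi_(quotv W) (h u).
have p_lin : linear p.
  by move=> a x y; rewrite /p linearP pi_addq -pi_scaleq.
have p_inj : injective p.
  move=> x y /eqP; rewrite -Quotient.idealrBE -linearB => /h_inj /eqP.
  by rewrite subr_eq0 => /eqP.
have p_surj q : exists u, p u == q.
  elim/quotW: q => v; have [u vu] := h_surj v; exists u.
  by rewrite eq_sym -Quotient.idealrBE.
pose pL := GRing.isLinear.Build F U (quotv W) _ p p_lin.
exists (HB.pack p pL : {linear U -> quotv W}).
have pK : cancel (fun q => xchoose (p_surj q)) p.
  by move=> q; exact: (eqP (xchooseP (p_surj q))).
by exists (fun q => xchoose (p_surj q)) => // u; exact/p_inj/pK.
Qed.

End Isomorphisms.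

(** * Harmonic elements and Hodge decomposition *)

Section Harmonic.
Variables (R : realType) (F : numFieldType) (conj : {rmorphism F -> F}).
Hypothesis hF : real_or_complex R conj.
Variables (d : Order.disp_t) (V : finOrderType d) (H : hypergraph V).
Implicit Types (A B C : {vspace chain H F}) (x y : chain H F).

Lemma inner_conj x y : inner conj y x = conj (inner conj x y).
Proof.
rewrite rmorph_sum; apply: eq_bigr => s _.
by rewrite rmorphM (real_or_complex_conjK hF) mulrC.
Qed.

Lemma inner_ge0 x : 0 <= inner conj x x.
Proof. by apply: sumr_ge0 => s _; exact: (real_or_complex_mul_conj_ge0 hF). Qed.

Lemma inner0l y : inner conj 0 y = 0.
Proof. by rewrite -(scale0r y) innerZl mul0r. Qed.

Lemma inner0r x : inner conj x 0 = 0.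
Proof. by rewrite inner_conj inner0l rmorph0. Qed.

Lemma inner_subvs_eq0 A (a : subvs_of A) :
  inner conj (vsval a) (vsval a) = 0 -> a = 0.
Proof. by move/(inner_eq0 hF) => a0; apply: val_inj. Qed.

Section Adjoint.
Variables (A B : {vspace chain H F}) (f : 'Hom(subvs_of A, subvs_of B)).

(** If b = f a and f^* b = 0, then <b, b> = <f a, b> = <a, f^* b> = 0. *)
Lemma limg_cap_lker_adjoint : (limg f :&: lker (adjoint conj f) = 0)%VS.
Proof.
apply/eqP; rewrite -subv0; apply/subvP => b; rewrite memv_cap memv_ker memv0.
move=> /andP[/memv_imgP[a _ bE] /eqP fb]; apply/eqP/inner_subvs_eq0.
by rewrite {1}bE (adjointP hF f) fb inner0r.
Qed.

(** The mirror image of [limg_cap_lker_adjoint], used to bound the rank of the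
adjoint by the rank of [f]. *)
Lemma limg_adjoint_cap_lker : (limg (adjoint conj f) :&: lker f = 0)%VS.
Proof.
apply/eqP; rewrite -subv0; apply/subvP => a; rewrite memv_cap memv_ker memv0.
move=> /andP[/memv_imgP[b _ aE] /eqP fa]; apply/eqP/inner_subvs_eq0.
by rewrite {2}aE -(adjointP hF f) fa inner0l.
Qed.

(** By [limg_adjoint_cap_lker] and the rank theorem for [f], the adjoint has rank
at most that of [f].  The rank theorem for the adjoint then makes its kernel
large enough for the sum, direct by [limg_cap_lker_adjoint], to be
everything. *)
Lemma limg_add_lker_adjoint : (limg f + lker (adjoint conj f))%VS = fullv.
Proof.
apply/eqP; rewrite eqEdim subvf dimv_disjoint_sum ?limg_cap_lker_adjoint//=.
have rank : (\dim (limg (adjoint conj f)) <= \dim (limg f))%N.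
  rewrite -(leq_add2r (\dim (lker f))) -dimv_disjoint_sum.
    by rewrite addnC -[lker f]capfv limg_ker_dim dimvS ?subvf.
  exact: limg_adjoint_cap_lker.
by rewrite -(limg_ker_dim (adjoint conj f)) capfv addnC leq_add2r.
Qed.

End Adjoint.

Definition harmonic A B C (f : 'Hom(subvs_of A, subvs_of B))
    (g : 'Hom(subvs_of B, subvs_of C)) : {vspace subvs_of B} :=
  (lker g :&: lker (adjoint conj f))%VS.

Variables (A B C : {vspace chain H F}).
Variables (f : 'Hom(subvs_of A, subvs_of B)) (g : 'Hom(subvs_of B, subvs_of C)).

(** If b is killed by L = f f^* + g^* g, then
0 = <b, L b> = |g b|^2 + |f^* b|^2, and both summands are nonnegative. *)
Lemma lker_laplacian :
  lker ((f \o adjoint conj f) + (adjoint conj g \o g))%VF = harmonic f g.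
Proof.
apply/vspaceP => b; rewrite memv_cap !memv_ker lfun_simp !comp_lfunE.
apply/eqP/andP => [Lb|[/eqP-> /eqP->]]; last by rewrite !linear0 addr0.
have: inner conj (vsval (g b)) (vsval (g b)) +
    inner conj (vsval (adjoint conj f b)) (vsval (adjoint conj f b)) = 0.
  rewrite [X in X + _](adjointP hF) [X in _ + X]inner_conj.
  rewrite -[X in _ + conj X](adjointP hF) -inner_conj -innerDr -linearD.
  by rewrite addrC Lb linear0 inner0r.
move/eqP; rewrite paddr_eq0 ?inner_ge0// => /andP[/eqP gb /eqP fb].
by split; apply/eqP/inner_subvs_eq0.
Qed.

Hypothesis gf0 : forall a, g (f a) = 0.

Lemma limg_sub_lker : (limg f <= lker g)%VS.
Proof. by apply/subvP => _ /memv_imgP[a _ ->]; rewrite memv_ker gf0. Qed.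

(** Intersect the decomposition of [limg_add_lker_adjoint] with Ker g: as Ker g
contains im f, the modular law distributes the intersection. *)
Lemma hodge_decomposition : (harmonic f g + limg f)%VS = lker g.
Proof.
rewrite vspace_modr ?limg_sub_lker// addvC.
by rewrite limg_add_lker_adjoint capvf.
Qed.

Lemma limg_cap_harmonic : (harmonic f g :&: limg f = 0)%VS.
Proof.
by rewrite -capvA [(lker _ :&: limg _)%VS]capvC limg_cap_lker_adjoint capv0.
Qed.

Lemma dim_harmonic : (\dim (harmonic f g) + \dim (limg f))%N = \dim (lker g).
Proof. by rewrite -dimv_disjoint_sum ?limg_cap_harmonic// hodge_decomposition. Qed.

(** The sum in [hodge_decomposition] is direct, so each homology class contains
exactly one harmonic element. *)
Lemma homology_harmonic :
  isomorphic (homology f g) (subvs_of (harmonic f g)).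
Proof.
apply: (isomorphic_quotv
    (h := vsproj (lker g) \o vsval : {linear subvs_of (harmonic f g) -> _})).
- move=> h; rewrite -memv_preim lfunE/= vsprojK; last first.
    by have := subvsP h; rewrite memv_cap => /andP[].
  move=> hf; apply/val_inj/eqP.
  by rewrite -memv0 -limg_cap_harmonic memv_cap subvsP.
- move=> z; have : vsval z \in (harmonic f g + limg f)%VS.
    by rewrite hodge_decomposition subvsP.
  move=> /memv_addP[h hh [b bf zE]]; exists (Subvs hh).
  rewrite -memv_preim lfunE linearB/= vsprojK.
    by rewrite zE addrC addKr.
  by move: hh; rewrite memv_cap => /andP[].
Qed.

End Harmonic.

(** * Kernel and image of a restricted map *)

Section RestrictDim.
Variables (F : fieldType) (vT : vectType F).
Variables (f : 'End(vT)) (A B : {vspace vT}).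
Hypothesis fAB : {in A, forall a, f a \in B}.

(** The inclusion of [B] maps the image of the restricted map isomorphically onto
[f @: A].  This moves the comparison of Inf and Sup into the space of all
chains, where subspaces of both complexes can be compared. *)
Lemma dim_limg_restrict : \dim (limg (Defs.restrict f A B)) = \dim (f @: A).
Proof.
pose v : 'Hom(subvs_of B, vT) := linfun vsval.
rewrite -(limg_dim_eq (f := v)); last first.
  suff /eqP-> : lker v == 0%VS by rewrite capv0.
  by apply/lker0P => x y; rewrite !lfunE; exact: val_inj.
congr (\dim _); apply/vspaceP => y; apply/memv_imgP/memv_imgP => [[b]|[a aA ->]].
  move=> /memv_imgP[a _ ->] ->; exists (vsval a); first exact: subvsP.
  by rewrite lfunE/= restrictE// fAB ?subvsP.
exists (Defs.restrict f A B (Subvs aA)); first exact/memv_img/memvf.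
by rewrite lfunE/= restrictE//= fAB.
Qed.

Lemma dim_lker_restrict : \dim (lker (Defs.restrict f A B)) = \dim (A :&: lker f).
Proof.
apply/eqP; rewrite -(eqn_add2r (\dim (f @: A))) limg_ker_dim.
by rewrite -dim_limg_restrict -[lker _]capfv limg_ker_dim dimvf.
Qed.

End RestrictDim.

(** * Cycles and boundaries of the complexes Inf and Sup *)

Section EmbeddedHomology.
Variables (d : Order.disp_t) (V : finOrderType d) (H : hypergraph V).
Variables (F : fieldType) (phi : {biscalar chain H F}).
Hypothesis hphi : is_weight phi.
Local Notation D := (hyperedge_chains H F).
Local Notation bd := (boundary phi).

Lemma boundary_boundaryS n c : bd n (bd (n + 1) c) = 0.
Proof. by have := boundary_boundary hphi (n + 1) c; rewrite addrK. Qed.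

Lemma boundaryS_Inf n : {in Inf phi (n + 1), forall c, bd (n + 1) c \in Inf phi n}.
Proof. by move=> c /(boundary_Inf hphi); rewrite addrK. Qed.

Lemma boundaryS_Sup n : {in Sup phi (n + 1), forall c, bd (n + 1) c \in Sup phi n}.
Proof. by move=> c /(boundary_Sup hphi); rewrite addrK. Qed.

Lemma sub_boundary_sub_boundaryS (C : int -> {vspace chain H F}) n :
    {in C (n + 1), forall c, bd (n + 1) c \in C n} ->
  forall c, sub_boundary phi C n (sub_boundaryS phi C n c) = 0.
Proof.
move=> bdC c; apply: val_inj.
have bc : bd (n + 1) (vsval c) \in C n by rewrite bdC ?subvsP.
have bbc : bd n (vsval (sub_boundaryS phi C n c)) = 0.
  by rewrite restrictE// boundary_boundaryS.
by rewrite [LHS]restrictE bbc ?mem0v.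
Qed.

Lemma limg_boundary_sub_lker n : (bd (n + 1) @: D (n + 1) <= lker (bd n))%VS.
Proof.
by apply/subvP => _ /memv_imgP[c _ ->]; rewrite memv_ker boundary_boundaryS.
Qed.

(** A chain of D_n with zero boundary meets the condition that defines Inf. *)
Lemma Inf_cap_lker n : (Inf phi n :&: lker (bd n) = D n :&: lker (bd n))%VS.
Proof.
apply/vspaceP => c; rewrite !memv_cap -memv_preim memv_ker.
by case: eqP => [->|_]; rewrite ?andbF// mem0v andbT.
Qed.

(** An element of D_(n+1) lies in Inf exactly when its boundary lies in D_n. *)
Lemma limg_Inf n : (bd (n + 1) @: Inf phi (n + 1) = D n :&: bd (n + 1) @: D (n + 1))%VS.
Proof.
apply/vspaceP => x; rewrite memv_cap.
apply/memv_imgP/andP => [[c]|[xD /memv_imgP[c cD xE]]].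
  rewrite memv_cap -memv_preim addrK => /andP[cD bcD] ->.
  by rewrite bcD memv_img.
by exists c; rewrite // memv_cap cD -memv_preim -xE addrK.
Qed.

(** The modular law applies, since boundaries of D_(n+1) are cycles. *)
Lemma Sup_cap_lker n :
  (Sup phi n :&: lker (bd n) =
     (D n :&: lker (bd n)) + bd (n + 1) @: D (n + 1))%VS.
Proof.
by rewrite [(D n :&: _)%VS]capvC vspace_modr ?limg_boundary_sub_lker// capvC.
Qed.

(** The part of Sup added to D_(n+1) consists of boundaries, which the boundary
map kills. *)
Lemma limg_Sup n : (bd (n + 1) @: Sup phi (n + 1) = bd (n + 1) @: D (n + 1))%VS.
Proof.
rewrite limgD [X in (_ + X)%VS](_ : _ = 0%VS) ?addv0//.
by apply/eqP; rewrite -lkerE limg_boundary_sub_lker.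
Qed.

(** Equality of the dimensions of cycles modulo boundaries for Sup and Inf, with
the subtracted terms moved across.  It is the dimension formula for the sum and
the intersection of D_n :&: Z_n and B_n, where Z_n are the cycles and B_n the
boundaries of D_(n+1). *)
Lemma dim_homology_Inf_Sup n :
  (\dim (Sup phi n :&: lker (bd n)) + \dim (bd (n + 1) @: Inf phi (n + 1)) =
   \dim (Inf phi n :&: lker (bd n)) + \dim (bd (n + 1) @: Sup phi (n + 1)))%N.
Proof.
rewrite Sup_cap_lker Inf_cap_lker limg_Inf limg_Sup -[RHS]dimv_sum_cap.
by rewrite -capvA (capv_idPr (limg_boundary_sub_lker n)).
Qed.

End EmbeddedHomology.

(** * Homology and harmonic chains of a weighted hypergraph *)

Theorem theorem4p12 (R : realType) (F : numFieldType)
    (conj : {rmorphism F -> F}) (hF : real_or_complex R conj)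
    (d : Order.disp_t) (V : finOrderType d) (H : hypergraph V)
    (phi : {biscalar chain H F}) (hphi : is_weight phi) (n : nat) :
  [/\ isomorphic (embedded_homology phi n)
        (subvs_of (lker (laplacian conj phi (Inf phi) n))),
      isomorphic (subvs_of (lker (laplacian conj phi (Inf phi) n)))
        (subvs_of (lker (laplacian conj phi (Sup phi) n))),
      isomorphic (embedded_homology phi n)
        (subvs_of (lker (sub_boundary phi (Inf phi) n) :&:
                   lker (adjoint conj (sub_boundaryS phi (Inf phi) n))))
    & isomorphic
        (subvs_of (lker (sub_boundary phi (Inf phi) n) :&:
                   lker (adjoint conj (sub_boundaryS phi (Inf phi) n))))
        (subvs_of (lker (sub_boundary phi (Sup phi) n) :&:
                   lker (adjoint conj (sub_boundaryS phi (Sup phi) n))))].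
Proof.
rewrite /laplacian !(lker_laplacian hF) /harmonic.
have Inf0 := sub_boundary_sub_boundaryS hphi (@boundaryS_Inf _ _ _ _ _ hphi n).
have Sup0 := sub_boundary_sub_boundaryS hphi (@boundaryS_Sup _ _ _ _ _ hphi n).
have hodge := homology_harmonic hF Inf0.
suff Inf_Sup : isomorphic
    (subvs_of (harmonic conj (sub_boundaryS phi (Inf phi) n)
                             (sub_boundary phi (Inf phi) n)))
    (subvs_of (harmonic conj (sub_boundaryS phi (Sup phi) n)
                             (sub_boundary phi (Sup phi) n))) by [].
apply: isomorphic_dim; apply/eqP.
set S := sub_boundaryS phi (Inf phi) n; set T := sub_boundaryS phi (Sup phi) n.
(* Adding both ranks completes each harmonic dimension to that of a space of
   cycles, by [dim_harmonic], and leaves the rank of the other complex. *)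
rewrite -(eqn_add2r (\dim (limg S) + \dim (limg T))) addnA.
rewrite [eqbRHS]addnCA [eqbRHS]addnC.
rewrite [X in (X + _)%N == _](dim_harmonic hF Inf0).
rewrite [X in _ == (X + _)%N](dim_harmonic hF Sup0).
rewrite !dim_limg_restrict ?dim_lker_restrict.
- exact/eqP/esym/dim_homology_Inf_Sup.
- exact: boundary_Sup.
- exact: boundary_Inf.
- exact: boundaryS_Inf.
- exact: boundaryS_Sup.
Qed.
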